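(* Let $K$ be a compact Hausdorff space. The following are equivalent: (i) $K$ has finitely many non-isolated points; (ii) $\mathcal{C}(K)_a$ has finite codimension in $\mathcal{C}(K)$; (iii) the pointwise topology on $\mathcal{C}(K)$ has the Kadec-Pelczynski property; (iii$'$) the pointwise topology on $\mathcal{C}(K)$ has the sequential Kadec-Pelczynski property; (iv) the weak topology on $\mathcal{C}(K)$ has the sequential Kadec-Pelczynski property; (iv$'$) the absolute weak topology on $\mathcal{C}(K)$ has the sequential Kadec-Pelczynski property; (v) $\mathcal{C}(K)$ contains no infinite-dimensional dispersed closed subspace; (v$'$) $\mathcal{C}(K)$ contains no infinite-dimensional $2$-dispersed closed subspace.
   Context: $\mathcal{C}(K)$ is the Banach lattice of real continuous functions with sup-norm and pointwise order. For a Banach lattice $F$, $F_a$ is its order continuous part: the largest ideal of $F$ on which the norm is order continuous. $\mathrm{S}_F$ is the unit sphere. A sequence $(e_n)\subset\mathrm{S}_F$ is almost disjoint if there is a disjoint sequence $(f_n)\subset F$ ($|f_n|\wedge|f_m|=0$, $n\neq m$) with $\|e_n-f_n\|\to0$. A closed subspace $E$ is dispersed if it contains no almost disjoint sequence; it is $2$-dispersed if there is $r>0$ such that there are no disjoint $f_1,f_2\in\mathrm{S}_F$ with $d(f_1,E)<r$ and $d(f_2,E)<r$. A linear topology $\tau$ on $F$ has the Kadec-Pelczynski property if whenever $(f_p)_{p\in P}\subset\mathrm{S}_F$ is a $\tau$-null net and $(q_n)_{n\in\mathbb{N}}\subset P$, there are $p_n\in P$ with $p_n\ge q_n$ for all $n$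 such that $(f_{p_n})_n$ is almost disjoint; it has the sequential Kadec-Pelczynski property if every $\tau$-null sequence in $\mathrm{S}_F$ has an almost disjoint subsequence. The absolute weak topology is the linear topology with zero neighborhood base $\{f:\nu(|f|)<\varepsilon\}$, $\nu\in F^*_+$, $\varepsilon>0$. *)

(* Defs.v *)
(* C(K) is represented by the continuous functions
   K -> R (R : realType, the reals), with sup-norm and pointwise order. *)
From mathcomp Require Import all_boot all_order all_algebra.
From mathcomp Require Import all_classical all_reals all_analysis.
Set Implicit Arguments. Unset Strict Implicit. Unset Printing Implicit Defensive.
Import Order.TTheory GRing.Theory Num.Theory.
Import numFieldNormedType.Exports.
Local Open Scope classical_set_scope.
Local Open Scope ring_scope.

Section CK.
Variables (R : realType) (K : topologicalType).

Definition inCK (f : K -> R) : Prop := continuous f.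

Definition supnorm (f : K -> R) : R := sup [set `|f x| | x in [set: K]].

Definition in_sphere (f : K -> R) : Prop := inCK f /\ supnorm f = 1.

Definition disj (f g : K -> R) : Prop := forall x, Num.min `|f x| `|g x| = 0.

Definition almost_disjoint (e : nat -> K -> R) : Prop :=
  (forall n, in_sphere (e n)) /\
  exists f : nat -> K -> R,
    (forall n, inCK (f n)) /\
    (forall n m, n <> m -> disj (f n) (f m)) /\
    (fun n => supnorm (e n \- f n)) @ \oo --> (0 : R).

Definition closed_subspace (E : set (K -> R)) : Prop :=
  (forall f, E f -> inCK f) /\
  E (fun _ => 0) /\
  (forall (a : R) f g, E f -> E g -> E (fun x => a * f x + g x)) /\
  (forall (g : nat -> K -> R) f, (forall n, E (g n)) -> inCK f ->
     (fun n => supnorm (g n \- f)) @ \oo --> (0 : R) -> E f).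

Definition infinite_dimensional (E : set (K -> R)) : Prop :=
  forall n : nat, exists e : 'I_n -> K -> R,
    (forall i, E (e i)) /\
    (forall c : 'I_n -> R, (forall x, \sum_(i < n) c i * e i x = 0) ->
        forall i, c i = 0).

Definition dist (f : K -> R) (E : set (K -> R)) : R :=
  inf [set supnorm (f \- g) | g in E].

Definition dispersed (E : set (K -> R)) : Prop :=
  closed_subspace E /\
  ~ (exists e : nat -> K -> R, (forall n, E (e n)) /\ almost_disjoint e).

Definition two_dispersed (E : set (K -> R)) : Prop :=
  closed_subspace E /\
  exists r : R, 0 < r /\
    ~ (exists f1 f2 : K -> R, in_sphere f1 /\ in_sphere f2 /\ disj f1 f2 /\
         dist f1 E < r /\ dist f2 E < r).

Definition directed (P : Type) (le : P -> P -> Prop) : Prop :=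
  (forall p, le p p) /\ (forall p q s, le p q -> le q s -> le p s) /\
  (exists p : P, True) /\ (forall p q, exists s, le p s /\ le q s).

Definition net_null (P : Type) (le : P -> P -> Prop) (u : P -> R) : Prop :=
  forall eps : R, 0 < eps -> exists p0, forall p, le p0 p -> `|u p| < eps.

Definition ideal (I : set (K -> R)) : Prop :=
  (forall f, I f -> inCK f) /\
  I (fun _ => 0) /\
  (forall (a : R) f g, I f -> I g -> I (fun x => a * f x + g x)) /\
  (forall f g, I f -> inCK g -> (forall x, `|g x| <= `|f x|) -> I g).

Definition decr_to_0 (P : Type) (le : P -> P -> Prop) (xn : P -> K -> R) : Prop :=
  (forall p, inCK (xn p)) /\
  (forall p q, le p q -> forall t, xn q t <= xn p t) /\
  (forall p t, 0 <= xn p t) /\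
  (forall g, inCK g -> (forall p t, g t <= xn p t) -> forall t, g t <= 0).

Definition norm_oc_on (I : set (K -> R)) : Prop :=
  forall (P : Type) (le : P -> P -> Prop) (xn : P -> K -> R),
    directed le -> (forall p, I (xn p)) -> decr_to_0 le xn ->
    net_null le (fun p => supnorm (xn p)).

(* C(K)_a : the largest ideal on which the norm is order continuous,
   i.e. the union of all such ideals *)
Definition oc_part : set (K -> R) :=
  [set f | exists I, ideal I /\ norm_oc_on I /\ I f].

Definition finite_codim (A : set (K -> R)) : Prop :=
  exists (n : nat) (g : 'I_n -> K -> R), (forall i, inCK (g i)) /\
    forall f, inCK f -> exists c : 'I_n -> R,
      A (fun x => f x - \sum_(i < n) c i * g i x).

Definition ck_linear (nu : (K -> R) -> R) : Prop :=
  forall (a : R) f g, inCK f -> inCK g ->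
    nu (fun x => a * f x + g x) = a * nu f + nu g.

Definition dual_elt (nu : (K -> R) -> R) : Prop :=
  ck_linear nu /\ exists M : R, forall f, inCK f -> `|nu f| <= M * supnorm f.

Definition dual_pos (nu : (K -> R) -> R) : Prop :=
  dual_elt nu /\ forall f, inCK f -> (forall x, 0 <= f x) -> 0 <= nu f.

Definition pointwise_null_net (P : Type) (le : P -> P -> Prop) (fn : P -> K -> R) :=
  forall t, net_null le (fun p => fn p t).

Definition pointwise_null_seq (fn : nat -> K -> R) : Prop :=
  forall t, (fun n => fn n t) @ \oo --> (0 : R).

Definition weak_null_seq (fn : nat -> K -> R) : Prop :=
  forall nu, dual_elt nu -> (fun n => nu (fn n)) @ \oo --> (0 : R).

Definition absweak_null_seq (fn : nat -> K -> R) : Prop :=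
  forall nu, dual_pos nu -> (fun n => nu (fun x => `|fn n x|)) @ \oo --> (0 : R).

Definition KP_pointwise : Prop :=
  forall (P : Type) (le : P -> P -> Prop) (fn : P -> K -> R),
    directed le -> (forall p, in_sphere (fn p)) -> pointwise_null_net le fn ->
    forall q : nat -> P, exists pn : nat -> P,
      (forall n, le (q n) (pn n)) /\ almost_disjoint (fun n => fn (pn n)).

Definition seqKP (null : (nat -> K -> R) -> Prop) : Prop :=
  forall fn : nat -> K -> R, (forall n, in_sphere (fn n)) -> null fn ->
    exists phi : nat -> nat, (forall n, (phi n < phi n.+1)%N) /\
      almost_disjoint (fun n => fn (phi n)).

Definition non_isolated : set K := [set x | ~ open [set x]].

End CK.

(* Main.v *)
Require Import Defs.
From mathcomp Require Import all_boot all_order all_algebra.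
From mathcomp Require Import all_classical all_reals all_analysis.
From mathcomp Require Import ring lra.
Set Implicit Arguments. Unset Strict Implicit. Unset Printing Implicit Defensive.
Import Order.TTheory GRing.Theory Num.Theory.
Import numFieldNormedType.Exports.
Local Open Scope classical_set_scope.
Local Open Scope ring_scope.

(* Let N be the set of non-isolated points.  The order continuous part consists of the functions
   vanishing on N, hence has finite codimension exactly when N is finite.  If N is finite, functions that
   tend to 0 at every point, or unit vectors of an infinite-dimensional subspace chosen to vanish
   on prescribed finite sets, are large only at finitely many isolated points, and a gliding hump
   extracts an almost disjoint sequence.  If N is infinite, choose disjoint bumps h_n around points
   t_n of N and, below each h_k, disjoint spikes g_(k,n) for n > k.  The functions
   f_n = h_n + \sum_(k < n) g_(k,n) are weakly null because \sum_n f_n <= 2, yet any two of them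
   equal 1 at a common point.  Their closed span is 2-dispersed: if u and v in it have large
   coefficients at i < j respectively, they overlap at t_i, at t_j, or at the tip of g_(i,j), where
   the values are u(t_i) + u(t_j) and v(t_i) + v(t_j). *)

(** * Continuous functions on a compact space *)

Lemma cvgn0P (R : realType) (u : nat -> R) : u @ \oo --> (0 : R) <->
  forall eps, 0 < eps -> exists N, forall n, (N <= n)%N -> `|u n| < eps.
Proof.
rewrite cvgr0Pnorm_lt; split=> H eps e0.
  by have [N _ HN] := H _ e0; exists N => n Nn; exact: HN.
by have [N HN] := H _ e0; exists N => // n /= Nn; exact: HN.
Qed.

Section ContinuousFunctions.
Context (R : realType) (K : topologicalType).
Implicit Types f g : K -> R.

Lemma inCK_cst (c : R) : @inCK R K (fun=> c).
Proof. by move=> x; exact: cvg_cst. Qed.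

Lemma inCKD f g : inCK f -> inCK g -> inCK (fun x => f x + g x).
Proof. by move=> cf cg x; apply: cvgD; [exact: cf|exact: cg]. Qed.

Lemma inCKM f g : inCK f -> inCK g -> inCK (fun x => f x * g x).
Proof. by move=> cf cg x; apply: cvgM; [exact: cf|exact: cg]. Qed.

Lemma inCKZ (a : R) f : inCK f -> inCK (fun x => a * f x).
Proof. by move=> cf; apply: inCKM => //; exact: inCK_cst. Qed.

Lemma inCKN f : inCK f -> inCK (fun x => - f x).
Proof. by move=> cf x; apply: cvgN; exact: cf. Qed.

Lemma inCKB f g : inCK f -> inCK g -> inCK (fun x => f x - g x).
Proof. by move=> cf cg; apply: inCKD => //; exact: inCKN. Qed.

Lemma inCK_norm f : inCK f -> inCK (fun x => `|f x|).
Proof. by move=> cf x; apply: cvg_norm; exact: cf. Qed.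

Lemma inCK_max f g : inCK f -> inCK g -> inCK (fun x => Num.max (f x) (g x)).
Proof. by move=> cf cg x; apply: continuous_max; [exact: cf|exact: cg]. Qed.

Lemma inCK_min f g : inCK f -> inCK g -> inCK (fun x => Num.min (f x) (g x)).
Proof. by move=> cf cg x; apply: continuous_min; [exact: cf|exact: cg]. Qed.

Lemma inCK_sum (I : Type) (r : seq I) (P : pred I) (F : I -> K -> R) :
  (forall i, P i -> inCK (F i)) -> inCK (fun x => \sum_(i <- r | P i) F i x).
Proof.
move=> cF; elim: r => [|i r IH].
  by rewrite (_ : (fun _ => _) = fun=> 0); [exact: inCK_cst|apply/funext => x; rewrite big_nil].
have [Pi|nPi] := boolP (P i).
  rewrite (_ : (fun _ => _) = fun x => F i x + \sum_(i <- r | P i) F i x).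
    by apply: inCKD => //; exact: cF.
  by apply/funext => x; rewrite big_cons Pi.
by rewrite (_ : (fun _ => _) = fun x => \sum_(i <- r | P i) F i x) //;
  apply/funext => x; rewrite big_cons (negbTE nPi).
Qed.

Lemma inCK_prod (I : Type) (r : seq I) (P : pred I) (F : I -> K -> R) :
  (forall i, P i -> inCK (F i)) -> inCK (fun x => \prod_(i <- r | P i) F i x).
Proof.
move=> cF; elim: r => [|i r IH].
  by rewrite (_ : (fun _ => _) = fun=> 1); [exact: inCK_cst|apply/funext => x; rewrite big_nil].
have [Pi|nPi] := boolP (P i).
  rewrite (_ : (fun _ => _) = fun x => F i x * \prod_(i <- r | P i) F i x).
    by apply: inCKM => //; exact: cF.
  by apply/funext => x; rewrite big_cons Pi.
by rewrite (_ : (fun _ => _) = fun x => \prod_(i <- r | P i) F i x) //;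
  apply/funext => x; rewrite big_cons (negbTE nPi).
Qed.

Lemma inCK_open_gt f (c : R) : inCK f -> open [set x | c < f x].
Proof.
move=> cf; rewrite (_ : mkset _ = f @^-1` [set y | c < y])//.
by apply: open_comp; [move=> x _; exact: cf|exact: open_gt].
Qed.

Lemma inCK_closed_ge f (c : R) : inCK f -> closed [set x | c <= f x].
Proof.
move=> cf; rewrite (_ : mkset _ = f @^-1` [set y | c <= y])//.
by apply: preimage_closed; [move=> x _; exact: cf|exact: closed_ge].
Qed.

Lemma inCK_indic (t : K) (c : R) : hausdorff_space K -> open [set t] ->
  inCK (fun x => if x == t then c else 0).
Proof.
move=> hK ot x; have [->|xt] := eqVneq x t.
  apply: (@near_cst_continuous _ _ c).
  have : nbhs t [set t] by rewrite nbhsE; exists [set t] => //; split.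
  by apply: filterS => y ->; rewrite eqxx.
apply: (@near_cst_continuous _ _ 0).
have ct : closed [set t].
  by apply: accessible_closed_set1; exact: hausdorff_accessible.
have : nbhs x (~` [set t]).
  by rewrite nbhsE; exists (~` [set t]) => //; split; [exact/closed_openC|exact/eqP].
by apply: filterS => y /eqP/negbTE ->.
Qed.

Hypothesis cK : compact [set: K].

Lemma inCK_bounded f : inCK f -> exists M, forall x, `|f x| <= M.
Proof.
move=> cf.
have : compact (range f) by apply: continuous_compact => //; exact: continuous_subspaceT.
move/(@compact_bounded R R^o) => [M [_ HM]]; exists (M + 1) => x.
by apply: HM; [rewrite ltrDl|exists x].
Qed.

Lemma norm_le_supnorm f x : inCK f -> `|f x| <= supnorm f.
Proof.
move=> /inCK_bounded[M HM]; apply: ub_le_sup; last by exists x.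
by exists M => _ [y _ <-].
Qed.

Lemma supnorm_ge0 f : inCK f -> 0 <= supnorm f.
Proof.
move=> cf; have [|/set0P[_ [x _ _]]] := eqVneq [set `|f x| | x in [set: K]] set0.
  by rewrite /supnorm => ->; rewrite sup0.
exact: le_trans (normr_ge0 _) (norm_le_supnorm x cf).
Qed.

(** For empty [K] the set of values is empty and its [sup] is 0 by default; this is why [c] has to
    be nonnegative. *)
Lemma supnorm_le f (c : R) : 0 <= c -> (forall x, `|f x| <= c) -> supnorm f <= c.
Proof.
move=> c0 fc; rewrite /supnorm.
have [->|/set0P n0] := eqVneq [set `|f x| | x in [set: K]] set0.
  by rewrite sup0.
by apply: ge_sup => // _ [x _ <-].
Qed.

Lemma supnorm_gt f (c : R) : 0 <= c -> c < supnorm f -> exists x, c < `|f x|.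
Proof.
move=> c0 cf; apply: contrapT => H; move: cf; apply/negP; rewrite -leNgt.
apply: supnorm_le => // x; rewrite leNgt; apply/negP => cx; apply: H.
by exists x.
Qed.

End ContinuousFunctions.

(** * Bumps and disjoint sequences *)

Section Separation.
Context (R : realType) (K : topologicalType).
Hypotheses (hK : hausdorff_space K) (cK : compact [set: K]).

Definition bump_fun (f : K -> R) := inCK f /\ forall x, 0 <= f x <= 1.

Lemma bump_ge0 f x : bump_fun f -> 0 <= f x.
Proof. by case=> _ /(_ x)/andP[]. Qed.

Lemma bump_le1 f x : bump_fun f -> f x <= 1.
Proof. by case=> _ /(_ x)/andP[]. Qed.

Lemma bumpM f g : bump_fun f -> bump_fun g -> bump_fun (fun x => f x * g x).
Proof.
move=> bf bg; split; first by apply: inCKM; [case: bf|case: bg].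
move=> x; have := bump_ge0 x bf; have := bump_ge0 x bg.
by have := bump_le1 x bf; have := bump_le1 x bg; nra.
Qed.

Lemma bump_prod (I : Type) (r : seq I) (F : I -> K -> R) :
  (forall i, bump_fun (F i)) -> bump_fun (fun x => \prod_(i <- r) F i x).
Proof.
move=> bF; split; first by apply: inCK_prod => i _; case: (bF i).
move=> x; apply/andP; split; first by apply: prodr_ge0 => i _; exact: bump_ge0.
by apply: prodr_ile1 => i _; case: (bF i).
Qed.

Lemma bump_separates (x y : K) : x <> y -> exists u, [/\ bump_fun u, u x = 0 & u y = 1].
Proof.
move=> xy.
have c1 (z : K) : closed [set z] by exact: (accessible_closed_set1 (hausdorff_accessible hK)).
have dxy : [set x] `&` [set y] = set0.
  by apply/seteqP; split => // z [] /= zx zy; case: xy; rewrite -zx -zy.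
have [u [cu u0 u1 u01]] := @urysohn_ext_itv _ R (compact_normal hK cK)
    _ _ 0 1 (c1 x) (c1 y) dxy ltr01.
exists u; split.
- by split => // z; have := u01 (u z) (ex_intro2 _ _ z I erefl); rewrite /= in_itv.
- by apply: u0; exists x.
- by apply: u1; exists y.
Qed.

(* [2 u - 1] and [1 - 2 u] have disjoint positivity sets whose complements cover K, so one of
   their positive parts vanishes on infinitely many points of A. *)
Lemma bump_leaving_infinite (A : set K) : infinite_set A ->
  exists (y : K) (f : K -> R), [/\ A y, bump_fun f, f y = 1 &
    infinite_set (A `&` [set x | f x = 0])].
Proof.
move=> iA.
have [x Ax] := infinite_setN0 iA.
have [y [Ay /= nyx]] := infinite_setN0 (infinite_setD iA (finite_set1 x)).
have [u [bu ux uy]] := @bump_separates x y (fun h => nyx (esym h)).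
have key (v : K -> R) z : bump_fun v -> A z -> v z = 1 ->
    infinite_set (A `&` [set x | v x <= 1/2]) ->
    exists (y : K) (f : K -> R), [/\ A y, bump_fun f, f y = 1 &
      infinite_set (A `&` [set x | f x = 0])].
  move=> bv Az vz iv; exists z, (fun x => Num.max 0 (2 * v x - 1)); split => //.
  - split; first by apply: inCK_max; [exact: inCK_cst|apply: inCKB;
      [apply: inCKZ; case: bv|exact: inCK_cst]].
    by move=> t; have := bump_le1 t bv; rewrite le_max lexx ge_max /= => ?; lra.
  - by rewrite vz max_r; lra.
  - apply: sub_infinite_set iv => t [At /= vt]; split => //=.
    by rewrite max_l//; lra.
have [fu|] := pselect (finite_set (A `&` [set x | u x <= 1/2])); last exact: (key u y bu Ay uy).
apply: (key (fun t => 1 - u t) x) => //.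
- split; first by apply: inCKB; [exact: inCK_cst|case: bu].
  by move=> t; have := bump_le1 t bu; have := bump_ge0 t bu; lra.
- by rewrite ux subr0.
- move=> fv; apply: iA.
  have : finite_set ((A `&` [set x | u x <= 1/2]) `|` (A `&` [set x | 1 - u x <= 1/2])).
    by rewrite finite_setU.
  apply: sub_finite_set => t At.
  have [h|h] := leP (u t) (1/2); [left|right]; split => //=; lra.
Qed.

(** Iterating [bump_leaving_infinite] inside the zero sets gives points [y n] at which all earlier
    bumps vanish, but the bumps may still overlap. Multiplying a function supported where [f n] is
    large by functions supported where the earlier [f k] are small removes the overlap. *)
Lemma disjoint_bumps (A : set K) : infinite_set A ->
  exists (y : nat -> K) (f : nat -> K -> R), [/\ forall n, A (y n), forall n, bump_fun (f n),
    forall n, f n (y n) = 1 & forall n m x, n <> m -> f n x * f m x = 0].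
Proof.
move=> iA.
pose X := {p : set K * (K * (K -> R)) | infinite_set p.1}.
pose S (p q : X) := let B := (sval p).1 in let y := (sval q).2.1 in let f := (sval q).2.2 in
  [/\ B y, bump_fun f, f y = 1 & (sval q).1 = B `&` [set x | f x = 0]].
have step (p : X) : {q : X | S p q}.
  apply: cid; case: p => -[B [y0 f0]] /= iB.
  have [y [f [By bf fy iBf]]] := bump_leaving_infinite iB.
  by exists (exist _ (B `&` [set x | f x = 0], (y, f)) iBf); split.
have [a Aa] := infinite_setN0 iA.
have [q [q0 Sq]] := dependent_choice step
  (exist (fun p => infinite_set p.1) (A, (a, fun=> 0 : R)) iA : X).
(* State 0 carries a placeholder point and function, so the n-th choice is read off state [n.+1]. *)
pose B n := (sval (q n)).1; pose y n := (sval (q n.+1)).2.1.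
pose f n := (sval (q n.+1)).2.2.
have By n : B n (y n) by have [] := Sq n.
have bf n : bump_fun (f n) by have [] := Sq n.
have fy n : f n (y n) = 1 by have [] := Sq n.
have Bf n : B n.+1 = B n `&` [set x | f n x = 0] by have [] := Sq n.
have Bsub n k : B (n + k)%N `<=` B n.
  elim: k => [|k IH]; first by rewrite addn0.
  by rewrite addnS Bf => x [/IH].
have fy0 k n : (k < n)%N -> f k (y n) = 0.
  move=> kn; have := By n; rewrite -(subnKC kn) => /Bsub.
  by rewrite Bf => -[].
(* Cutting at height 1/2 makes [g n * h n] vanish, while [g n (y n) = 1] and [h k (y n) = 1] for
   [k < n] because [f k (y n) = 0]. *)
pose g n x := Num.max 0 (2 * f n x - 1).
pose h n x := Num.max 0 (1 - 2 * f n x).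
have bg n : bump_fun (g n).
  split; first by apply: inCK_max; [exact: inCK_cst|apply: inCKB;
    [apply: inCKZ; case: (bf n)|exact: inCK_cst]].
  by move=> t; have := bump_le1 t (bf n); rewrite /g le_max lexx ge_max /= => ?; lra.
have bh n : bump_fun (h n).
  split; first by apply: inCK_max; [exact: inCK_cst|apply: inCKB;
    [exact: inCK_cst|apply: inCKZ; case: (bf n)]].
  by move=> t; have := bump_ge0 t (bf n); rewrite /h le_max lexx ge_max /= => ?; lra.
have gh n x : g n x * h n x = 0.
  rewrite /g /h; have [k|k] := leP (f n x) (1/2).
    by rewrite (max_l (_ : 2 * f n x - 1 <= 0)) ?mul0r//; lra.
  by rewrite (max_l (_ : 1 - 2 * f n x <= 0)) ?mulr0//; lra.
exists y, (fun n x => g n x * \prod_(k < n) h k x); split.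
- by move=> n; have := By n; rewrite -(add0n n) => /Bsub; rewrite /B q0.
- by move=> n; apply: bumpM => //; apply: bump_prod.
- move=> n; rewrite big1 ?mulr1; first by rewrite /g fy max_r; lra.
  by move=> k _; rewrite /h fy0// max_r; lra.
- move=> n m x nm; wlog : n m nm / (n < m)%N => [wl|lt_nm].
    have [|/wl|//] := ltngtP n m; first exact: wl.
    by rewrite mulrC; apply; exact: nesym.
  rewrite (bigD1 (Ordinal lt_nm))//=.
  set p1 := \prod_(k < n) _; set q1 := \prod_(k < m | _) _.
  transitivity ((g n x * h n x) * (p1 * g m x * q1)); first by ring.
  by rewrite gh mul0r.
Qed.
End Separation.

Section DisjointSequences.
Context (R : realType) (a : nat -> R).
Hypothesis disj_a : forall n m, n <> m -> a n * a m = 0.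

Lemma disjoint_one_nonzero : exists k, forall n, n <> k -> a n = 0.
Proof.
have [[k ak]|h] := pselect (exists k, a k <> 0).
  exists k => n /disj_a/eqP; rewrite mulf_eq0 => /orP[/eqP//|/eqP].
  by move=> /ak.
by exists 0%N => n _; apply: contrapT => an; apply: h; exists n.
Qed.

Lemma disjoint_eventually0 : exists M, forall n, (M <= n)%N -> a n = 0.
Proof.
have [k ak] := disjoint_one_nonzero.
by exists k.+1 => n kn; apply: ak => nk; rewrite nk ltnn in kn.
Qed.

Lemma disjoint_sum_le1 M : (forall n, 0 <= a n <= 1) -> \sum_(n < M) a n <= 1.
Proof.
move=> a01; have [k ak] := disjoint_one_nonzero.
have [kM|Mk] := ltnP k M.
  rewrite (bigD1 (Ordinal kM))//= big1 ?addr0; first by case/andP: (a01 k).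
  by move=> i /eqP ik; apply: ak => h; apply: ik; exact: val_inj.
rewrite big1// => i _; apply: ak => h.
by have := ltn_ord i; rewrite h ltnNge Mk.
Qed.
End DisjointSequences.

(** * Entangled bumps around infinitely many non-isolated points *)

Section EntangledBumps.
Context (R : realType) (K : topologicalType).
Hypotheses (hK : hausdorff_space K) (cK : compact [set: K]).

(** A finite punctured neighbourhood would be closed, and removing it from [U] would leave the open
    set [[set t]]. *)
Lemma non_isolated_nbhs_infinite (t : K) (U : set K) :
  non_isolated t -> open U -> U t -> infinite_set (U `\` [set t]).
Proof.
move=> nt oU Ut fU; apply: nt.
have cU : closed (U `\` [set t]).
  exact: (accessible_finite_set_closed.1 (hausdorff_accessible hK)).
rewrite (_ : [set t] = U `&` ~` (U `\` [set t])).
  by apply: openI => //; exact: closed_openC.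
apply/seteqP; split => x /=; first by move=> ->; split => // -[].
by case=> Ux h; apply: contrapT => xt; apply: h.
Qed.

(* The n-th function is [h n + \sum_(k < n) g k n], where the [h n] are disjoint and equal 1 near
   distinct non-isolated points [t n], and [g k n] is a thin spike below [h k] at [s k n]. *)
Lemma entangled_bumps : infinite_set (@non_isolated K) ->
  exists (f : nat -> K -> R) (t : nat -> K) (s : nat -> nat -> K),
  [/\ forall n, bump_fun (f n),
      forall n m, f n (t m) = (n == m)%:R,
      forall i j, (i < j)%N -> f i (s i j) = 1 /\ f j (s i j) = 1,
      forall x M, \sum_(n < M) f n x <= 2 &
      forall x, exists M, forall n, (M <= n)%N -> f n x = 0].
Proof.
move=> /(disjoint_bumps R hK cK)[t [p [Nt bp pt dp]]].
have spikes i : exists (s : nat -> K) (c : nat -> K -> R), [/\ forall j, 1/2 < p i (s j),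
    forall j, bump_fun (c j), forall j, c j (s j) = 1 /\ c j (t i) = 0 &
    forall j l x, j <> l -> c j x * c l x = 0].
  have oW : open [set x | 1/2 < p i x] by apply: inCK_open_gt; case: (bp i).
  have Wt : [set x | 1/2 < p i x] (t i) by rewrite /= pt; lra.
  have [s [c [Ws bc cs dc]]] :=
    disjoint_bumps R hK cK (non_isolated_nbhs_infinite (Nt i) oW Wt).
  (* The factor [w j] kills the spike at [t i], so that evaluation at the points [t m] will read off
     coefficients. *)
  have /choice[w wP] : forall j, exists u : K -> R, [/\ bump_fun u, u (t i) = 0 & u (s j) = 1].
    by move=> j; apply: bump_separates => //; case: (Ws j) => _ /= h /esym.
  exists s, (fun j x => c j x * w j x); split.
  - by move=> j; case: (Ws j).
  - by move=> j; apply: bumpM => //; case: (wP j).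
  - by move=> j; have [_ w0 w1] := wP j; rewrite cs w0 w1 mulr1 mulr0.
  - by move=> j l x jl; rewrite mulrACA dc// mul0r.
have [s /choice[c sc]] := choice spikes.
(* The truncation equals 1 on the whole region [1/2 < p n x], where the tips of the spikes lie. *)
pose h n x := Num.min 1 (2 * p n x).
have bh n : bump_fun (h n).
  split; first by apply: inCK_min; [exact: inCK_cst|apply: inCKZ; case: (bp n)].
  by move=> x; have := bump_ge0 x (bp n); rewrite /h ge_min le_min lexx /= => ?; lra.
have h_p x n : p n x = 0 -> h n x = 0 by move=> pz; rewrite /h pz mulr0 min_r.
have dh n m x : n <> m -> h n x * h m x = 0.
  by move=> /(dp n m x)/eqP; rewrite mulf_eq0 => /orP[]/eqP/h_p ->; rewrite ?mul0r ?mulr0.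
have ht n : h n (t n) = 1 by rewrite /h pt min_l//; lra.
have hs i j : h i (s i j) = 1.
  by have [H _ _ _] := sc i; rewrite /h min_l//; have := H j; lra.
have ht0 n m : n <> m -> h n (t m) = 0.
  by move=> nm; have := dh n m (t m) nm; rewrite ht mulr1.
pose g k n x := c k n x * h k x.
have bg k n : bump_fun (g k n) by apply: bumpM => //; case: (sc k).
have dg k n l m x : n <> m -> g k n x * g l m x = 0.
  move=> nm; rewrite /g mulrACA; have [->|/eqP kl] := eqVneq k l.
    by have [_ _ _ ->] := sc l; rewrite ?mul0r.
  by rewrite dh// mulr0.
have gh k n x : g k n x <= h k x.
  have [_ bc _ _] := sc k; have := bump_le1 x (bc n); have := bump_ge0 x (bh k).
  by rewrite /g; nra.
have gt k n m : g k n (t m) = 0.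
  rewrite /g; have [->|/eqP km] := eqVneq k m; last by rewrite ht0// mulr0.
  by have [_ _ H _] := sc m; have [_ ->] := H n; rewrite mul0r.
have gs k n : g k n (s k n) = 1.
  by rewrite /g hs mulr1; have [_ _ H _] := sc k; have [] := H n.
pose G n x := \sum_(k < n) g k n x.
have hsum x M : \sum_(n < M) h n x <= 1.
  apply: (@disjoint_sum_le1 _ (h ^~ x)) => [n m|n]; first exact: dh.
  by case: (bh n) => _; exact.
have G0 n x : 0 <= G n x by apply: sumr_ge0 => k _; exact: bump_ge0.
have Gh n x : G n x <= \sum_(k < n) h k x by apply: ler_sum => k _; exact: gh.
have dG n m x : n <> m -> G n x * G m x = 0.
  move=> nm; rewrite /G mulr_suml big1// => k _; rewrite mulr_sumr big1// => l _.
  exact: dg.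
(* As [g k n <= h k], the left side is at most [h 0 + ... + h n], a sum of disjoint functions
   bounded by 1. *)
have f1 n x : h n x + G n x <= 1.
  by apply: le_trans (hsum x n.+1); rewrite big_ord_recr/= [leRHS]addrC lerD2l.
exists (fun n x => h n x + G n x), t, s; split.
- move=> n; split.
    by apply: inCKD; [case: (bh n)|apply: inCK_sum => k _; case: (bg k n)].
  by move=> x; rewrite f1 addr_ge0// bump_ge0.
- move=> n m; rewrite /G big1 ?addr0; last by move=> k _; exact: gt.
  by have [->|/eqP nm] := eqVneq n m; rewrite ?ht ?ht0.
- move=> i j ij; split; apply/eqP; rewrite eq_le f1 /=.
    by rewrite hs lerDl.
  apply: le_trans (_ : G j (s i j) <= _); last by rewrite lerDr bump_ge0.
  rewrite /G (bigD1 (Ordinal ij))//= gs lerDl.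
  by apply: sumr_ge0 => k _; exact: bump_ge0.
(* Each of the disjoint families [h] and [G] sums to at most 1. *)
- move=> x M; rewrite big_split /= -[leRHS]/(1 + 1 : R); apply: lerD; first exact: hsum.
  apply: (@disjoint_sum_le1 _ (G ^~ x)) => [n m|n]; first exact: dG.
  by rewrite G0 (le_trans _ (f1 n x))// lerDr bump_ge0.
- move=> x; have [A hA] := disjoint_eventually0 (fun n m => @dh n m x).
  have [B GB] := disjoint_eventually0 (fun n m => @dG n m x).
  exists (maxn A B) => n; rewrite geq_max => /andP[An Bn].
  by rewrite hA// GB// addr0.
Qed.
End EntangledBumps.

(** * Null sequences and overlap *)

Section CompactSpace.
Context (R : realType) (K : topologicalType).
Hypothesis (cK : compact [set: K]).

Lemma disj_mulP (f g : K -> R) : disj f g <-> forall x, f x * g x = 0.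
Proof.
split=> h x.
  have := h x; rewrite minEle; case: ifP => _ /eqP; rewrite normr_eq0 => /eqP ->;
  by rewrite ?mul0r ?mulr0.
move/eqP: (h x); rewrite mulf_eq0 => /orP[]/eqP ->; rewrite normr0.
  by rewrite min_l.
by rewrite min_r.
Qed.

(** Late terms lie within less than 1/2 of the disjoint [g n]; at a common point of two of them
    neither approximant can vanish. *)
Lemma overlapping_not_almost_disjoint (e : nat -> K -> R) :
  (forall n m, exists x, 1/2 <= `|e n x| /\ 1/2 <= `|e m x|) -> ~ almost_disjoint e.
Proof.
move=> ov [se [g [cg [dg /cvgn0P lim]]]].
have [N HN] := lim (1/2) ltac:(lra).
have [x [ex1 ex2]] := ov N N.+1.
have near0 n : (N <= n)%N -> 1/2 <= `|e n x| -> g n x != 0.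
  move=> Nn en; apply/eqP => gn; have := HN n Nn.
  rewrite ger0_norm; last first.
    by apply: le_trans (norm_le_supnorm cK x _); [|apply: inCKB; [case: (se n)|]].
  have : `|(e n \- g n) x| <= supnorm (e n \- g n).
    by apply: norm_le_supnorm => //; apply: inCKB; [case: (se n)|].
  by rewrite /= gn subr0 => a b; lra.
have /disj_mulP/(_ x)/eqP := dg N N.+1 (n_Sn N).
by rewrite mulf_eq0 (negbTE (near0 _ _ _))// (negbTE (near0 _ _ _)).
Qed.

Lemma ck_linear0 (nu : (K -> R) -> R) : ck_linear nu -> nu (fun=> 0) = 0.
Proof.
move=> lin; have := lin (-1) (fun=> 0) (fun=> 0) (@inCK_cst _ _ _) (@inCK_cst _ _ _).
rewrite (_ : (fun _ => _) = fun=> 0); first by rewrite mulN1r addNr.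
by apply/funext => x; rewrite mulr0 addr0.
Qed.

Lemma ck_linearZ (nu : (K -> R) -> R) (a : R) f : ck_linear nu -> inCK f ->
  nu (fun x => a * f x) = a * nu f.
Proof.
move=> lin cf; rewrite -[RHS]addr0 -(ck_linear0 lin) -lin//; last exact: inCK_cst.
by congr nu; apply/funext => x; rewrite addr0.
Qed.

Lemma ck_linear_sum (nu : (K -> R) -> R) (f : nat -> K -> R) M :
  ck_linear nu -> (forall n, inCK (f n)) ->
  nu (fun x => \sum_(n < M) f n x) = \sum_(n < M) nu (f n).
Proof.
move=> lin cf; elim: M => [|M IH].
  rewrite big_ord0 -[RHS](ck_linear0 lin); congr nu.
  by apply/funext => x; rewrite big_ord0.
rewrite big_ord_recr/= -IH addrC -[nu (f M)]mul1r -lin//; last exact: inCK_sum.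
by congr nu; apply/funext => x; rewrite big_ord_recr/= mul1r addrC.
Qed.

(* Choosing signs, [\sum_(n < M) `|nu (f n)|] is the value of nu at a function of norm at most c. *)
Lemma weak_null_of_sum_bounded (f : nat -> K -> R) (c : R) :
  (forall n, inCK (f n)) -> (forall M x, \sum_(n < M) `|f n x| <= c) -> weak_null_seq f.
Proof.
(* The terms tend to 0 because the series of the [|nu (f n)|] has bounded partial sums. *)
move=> cf fc nu [lin [B nuB]]; apply/norm_cvg0P; apply: (@cvg_series_cvg_0 _ R^o).
apply: nondecreasing_is_cvgn.
  by apply/nondecreasing_seqP => n; rewrite /series /= big_nat_recr//= lerDl.
exists (`|B| * `|c|) => _ [M _ <-]; rewrite /series /= big_mkord.
pose g n x := Num.sg (nu (f n)) * f n x.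
have cg n : inCK (g n) by exact: inCKZ.
rewrite (eq_bigr (fun n : 'I_M => nu (g n))); last first.
  by move=> n _; rewrite ck_linearZ// -normrEsg.
rewrite -(ck_linear_sum M lin cg).
have cs : inCK (fun x => \sum_(n < M) g n x) by exact: inCK_sum.
apply: le_trans (ler_norm _) _; apply: le_trans (nuB _ cs) _.
apply: (@le_trans _ _ (`|B| * supnorm (fun x => \sum_(n < M) g n x))).
  by apply: ler_wpM2r; [exact: supnorm_ge0|exact: ler_norm].
apply: ler_wpM2l => //; apply: supnorm_le => // x.
apply: le_trans (ler_norm c); apply: le_trans (fc M x).
apply: le_trans (ler_norm_sum _ _ _) _; apply: ler_sum => n _.
by rewrite normrM ler_piMl// normr_sg lern1 leq_b1.
Qed.

Lemma absweak_null_of_weak_null (f : nat -> K -> R) :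
  (forall n x, 0 <= f n x) -> weak_null_seq f -> absweak_null_seq f.
Proof.
move=> f0 wf nu [dnu _]; rewrite (_ : (fun n => _) = fun n => nu (f n)); first exact: wf.
by apply/funext => n; congr nu; apply/funext => x; rewrite ger0_norm.
Qed.

(** Evaluation at [t] is a positive functional with bound 1. *)
Lemma absweak_null_pointwise (f : nat -> K -> R) :
  (forall n, inCK (f n)) -> absweak_null_seq f -> pointwise_null_seq f.
Proof.
move=> cf wf t; apply/norm_cvg0P; apply: (wf (fun g => g t)).
split; last by move=> g _; exact.
split; first by move=> a g h _ _.
by exists 1 => g cg; rewrite mul1r; exact: norm_le_supnorm.
Qed.

Lemma weak_null_pointwise (f : nat -> K -> R) :
  weak_null_seq f -> pointwise_null_seq f.
Proof.
move=> wf t; apply: (wf (fun g => g t)).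
split; first by move=> a g h _ _.
by exists 1 => g cg; rewrite mul1r; exact: norm_le_supnorm.
Qed.

End CompactSpace.

(** * The span of the entangled bumps *)

Section EntangledSpan.
Context (R : realType) (K : topologicalType).
Hypothesis (cK : compact [set: K]).
Context (f : nat -> K -> R) (t : nat -> K) (s : nat -> nat -> K).
Hypotheses (bf : forall n, bump_fun (f n)) (ft : forall n m, f n (t m) = (n == m)%:R)
  (fs : forall i j, (i < j)%N -> f i (s i j) = 1 /\ f j (s i j) = 1)
  (f2 : forall x M, \sum_(n < M) f n x <= 2)
  (fev : forall x, exists M, forall n, (M <= n)%N -> f n x = 0).

Lemma entangled_in_sphere n : in_sphere (f n).
Proof.
have cf : inCK (f n) by case: (bf n).
split => //; apply/eqP; rewrite eq_le; apply/andP; split.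
  by apply: supnorm_le => // x; rewrite ger0_norm ?bump_ge0// bump_le1.
by have := norm_le_supnorm cK (t n) cf; rewrite ft eqxx normr1.
Qed.

Lemma entangled_overlap n m : exists x, f n x = 1 /\ f m x = 1.
Proof.
have [nm|mn|->] := ltngtP n m.
- by exists (s n m); exact: fs.
- by exists (s m n); have [] := fs mn.
- by exists (t m); rewrite ft eqxx.
Qed.

Lemma entangled_subseq_not_almost_disjoint (p : nat -> nat) :
  ~ almost_disjoint (fun n => f (p n)).
Proof.
apply: overlapping_not_almost_disjoint => // n m.
have [x [fn fm]] := entangled_overlap (p n) (p m).
by exists x; rewrite fn fm normr1; lra.
Qed.

Lemma entangled_weak_null : weak_null_seq f.
Proof.
apply: (@weak_null_of_sum_bounded _ _ cK f 2) => [n|M x]; first by case: (bf n).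
by under eq_bigr do rewrite ger0_norm ?bump_ge0//.
Qed.

Lemma entangled_absweak_null : absweak_null_seq f.
Proof.
apply: absweak_null_of_weak_null entangled_weak_null => n x; exact: bump_ge0.
Qed.

(* The functions [\sum_n a n * f n] in C(K); the coefficients are recovered as [a n = g (t n)]. *)
Definition entangled_span : set (K -> R) := [set g | inCK g /\
  forall x M, (forall n, (M <= n)%N -> f n x = 0) -> g x = \sum_(n < M) g (t n) * f n x].

Lemma entangled_spanP n : entangled_span (f n).
Proof.
split; first by case: (bf n).
move=> x M HM; have [nM|/HM fn] := ltnP n M.
  rewrite (bigD1 (Ordinal nM))//= ft eqxx mul1r big1 ?addr0// => i /eqP ni.
  by rewrite ft; case: eqP => [h|]; [case: ni; exact: val_inj|rewrite mul0r].
rewrite fn big1// => i _; rewrite ft; case: eqP => [h|]; last by rewrite mul0r.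
by rewrite -h fn mulr0.
Qed.

Lemma entangled_span_infinite_dimensional : infinite_dimensional entangled_span.
Proof.
move=> n; exists (fun i => f i); split => [i|c c0 i]; first exact: entangled_spanP.
have := c0 (t i); rewrite (bigD1 i)//= ft eqxx mulr1 big1 ?addr0// => j ji.
by rewrite ft (_ : (_ == _) = false) ?mulr0//; exact/negbTE.
Qed.

(** Since [\sum_n f n <= 2], the coefficients control the sup-norm up to a factor 2. This makes the
    span closed and forces a large function to have a large coefficient. *)
Lemma entangled_span_sum_le (a : nat -> R) (c : R) x M :
  (forall n, `|a n| <= c) -> `|\sum_(n < M) a n * f n x| <= 2 * c.
Proof.
move=> ac; apply: le_trans (ler_norm_sum _ _ _) _.
apply: (@le_trans _ _ (\sum_(n < M) c * f n x)).
  apply: ler_sum => n _; rewrite normrM (ger0_norm (bump_ge0 x (bf n))).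
  by apply: ler_wpM2r => //; exact: bump_ge0.
rewrite -mulr_sumr mulrC ler_wpM2r//.
by apply: le_trans (normr_ge0 _) (ac 0%N).
Qed.

Lemma entangled_span_closed : closed_subspace entangled_span.
Proof.
split; first by move=> g [].
split.
  split; first exact: inCK_cst.
  by move=> x M _; rewrite big1// => n _; rewrite mul0r.
split.
  move=> a g h [cg gE] [ch hE]; split; first by apply: inCKD => //; exact: inCKZ.
  move=> x M HM; rewrite (gE x M HM) (hE x M HM) mulr_sumr -big_split.
  by apply: eq_bigr => n _ /=; rewrite mulrDl mulrA.
move=> g h gE ch /cvgn0P lim; split => // x M HM.
apply/eqP; rewrite -subr_eq0 -normr_le0; apply/ler_addgt0Pr => e e0; rewrite add0r.
(* The error is [d] from the value at [x] plus [2 * d] from the coefficients, hence the third of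
   [e]. *)
have [N /(_ N (leqnn N))] := lim (e / 3) ltac:(lra).
set d := supnorm _ => de; have {de} : d < e / 3 by apply: le_lt_trans de; exact: ler_norm.
have [cg gNE] := gE N.
have gh y : `|g N y - h y| <= d.
  by apply: (@norm_le_supnorm _ _ cK (g N \- h)); exact: inCKB.
have := @entangled_span_sum_le (fun n => g N (t n) - h (t n)) d x M (fun n => gh (t n)).
under eq_bigr do rewrite mulrBl.
rewrite sumrB -(gNE x M HM); set S := \sum_(n < M) _ => HS.
move=> de; have := gh x; rewrite distrC => ghx.
have -> : h x - S = (h x - g N x) + (g N x - S) by ring.
by apply: le_trans (ler_normD _ _) _; lra.
Qed.

Lemma entangled_span_large_coef g (c : R) x : entangled_span g -> 2 * c < `|g x| ->
  exists n, c < `|g (t n)|.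
Proof.
move=> [_ gE] cg; apply: contrapT => H.
have [M HM] := fev x.
move: cg; apply/negP; rewrite -leNgt (gE x M HM).
apply: (@entangled_span_sum_le (fun n => g (t n))) => n; rewrite leNgt.
by apply/negP => h; apply: H; exists n.
Qed.

(** At the tip [f i] and [f j] already exhaust the bound 2 on the sum, so every other [f n] vanishes
    there. *)
Lemma entangled_span_at_spike g i j : entangled_span g -> (i < j)%N ->
  g (s i j) = g (t i) + g (t j).
Proof.
move=> [_ gE] ij; have [fi fj] := fs ij.
have f0 n : n != i -> n != j -> f n (s i j) = 0.
  move=> ni nj; apply/eqP; rewrite eq_le bump_ge0// andbT.
  have := f2 (s i j) (maxn n j).+1.
  have lt k : (k <= maxn n j)%N -> (k < (maxn n j).+1)%N by [].
  have li := lt i (leq_trans (ltnW ij) (leq_maxr _ _)).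
  have lj := lt j (leq_maxr _ _); have ln := lt n (leq_maxl _ _).
  rewrite (bigD1 (Ordinal li))//= (bigD1 (Ordinal lj))/=; last first.
    by rewrite -val_eqE /= gtn_eqF.
  rewrite (bigD1 (Ordinal ln))/=; last by rewrite -!val_eqE /= ni nj.
  rewrite fi fj; set S := \sum_(k < _ | _) _.
  have : 0 <= S by apply: sumr_ge0 => k _; exact: bump_ge0.
  by lra.
rewrite (gE _ j.+1); last first.
  by move=> n jn; apply: f0; rewrite gtn_eqF//; exact: ltn_trans ij jn.
rewrite big_ord_recr/= fj mulr1; congr (_ + _).
rewrite (bigD1 (Ordinal ij))//= fi mulr1 big1 ?addr0// => n ni.
by rewrite f0 ?mulr0//; rewrite ?(ltn_eqF (ltn_ord n))//.
Qed.

Lemma entangled_span_two_dispersed : two_dispersed entangled_span.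
Proof.
split; first exact: entangled_span_closed.
(* A unit vector exceeds 19/20 somewhere, so an approximant within 1/20 exceeds 18/20 there and has
   a coefficient above 9/20. *)
exists (1/20); split; first by lra.
case=> u [v [su [sv [/disj_mulP duv [du dv]]]]].
have approx w : in_sphere w -> dist w entangled_span < 1/20 ->
    exists g n, [/\ entangled_span g, forall x, `|w x - g x| < 1/20 & 9/20 < `|g (t n)|].
  move=> [cw w1] /inf_lt[|_ [g Eg <-] wg].
    by exists (supnorm (w \- f 0%N)); exists (f 0%N) => //; exact: entangled_spanP.
  have cg : inCK g by case: Eg.
  have near x : `|w x - g x| < 1/20.
    by apply: le_lt_trans wg; apply: (@norm_le_supnorm _ _ cK (w \- g)); exact: inCKB.
  have [x wx] : exists x, 19/20 < `|w x| by apply: supnorm_gt => //; lra.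
  have [n gn] : exists n, 9/20 < `|g (t n)|.
    apply: (@entangled_span_large_coef g (9/20) x) => //.
    by have := near x; have := lerB_dist (w x) (g x); lra.
  by exists g, n.
have [g [i [Eg ug gi]]] := approx u su du.
have [h [j [Eh vh hj]]] := approx v sv dv.
(* Where both approximants reach 1/20, neither [u] nor [v] vanishes, against disjointness. So at
   [t i] and [t j] only one approximant is large, and at the spike between them both are. *)
have both x : 1/20 <= `|g x| -> 1/20 <= `|h x| -> False.
  move=> gx hx; have /eqP := duv x; rewrite mulf_eq0 => /orP[]/eqP z.
    by have := ug x; rewrite z sub0r normrN; lra.
  by have := vh x; rewrite z sub0r normrN; lra.
have hi : `|h (t i)| < 1/20 by rewrite ltNge; apply/negP; apply: both; lra.
have gj : `|g (t j)| < 1/20 by rewrite ltNge; apply/negP => ?; apply: (both (t j)) => //; lra.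
have large (a b : R) : 9/20 < `|a| -> `|b| < 1/20 -> 1/20 <= `|a + b|.
  by move=> ha hb; have := lerB_normD a b; lra.
have [ij|ji|ij] := ltngtP i j.
- by apply: (both (s i j)); rewrite entangled_span_at_spike//; [|rewrite addrC]; exact: large.
- by apply: (both (s j i)); rewrite entangled_span_at_spike//; [rewrite addrC|]; exact: large.
- by move: gj gi; rewrite ij; lra.
Qed.
End EntangledSpan.

(** * The gliding hump *)

Section FinitelyManyNonIsolated.
Context (R : realType) (K : topologicalType).
Hypotheses (hK : hausdorff_space K) (cK : compact [set: K]).

(* Otherwise the relatively cofinite subsets of A form a filter without cluster point in A. *)
Lemma closed_isolated_finite (A : set K) : closed A ->
  (forall x, A x -> open [set x]) -> finite_set A.
Proof.
move=> cA iA; apply: contrapT => infA.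
have kA : compact A by apply: (subclosed_compact cA cK).
pose F : set_system K := [set B | finite_set (A `\` B)].
have FF : ProperFilter F.
  apply: Build_ProperFilter; first by rewrite /F /= setD0.
  apply: Build_Filter; first by rewrite /F /= setDT; exact: finite_set0.
    by move=> B C FB FC; rewrite /F /= setDIr finite_setU.
  by move=> B C BC; apply: sub_finite_set; exact: setDS.
have FA : F A by rewrite /F /= setDv; exact: finite_set0.
have [x [Ax clx]] := kA F FF FA.
have Fx : F (A `\ x).
  apply: sub_finite_set (finite_set1 x) => z [Az /= nz].
  by apply: contrapT => zx; apply: nz.
have [z [[_ zx] zx']] := clx _ [set x] Fx (open_nbhs_nbhs (conj (iA x Ax) erefl)).
exact: zx.
Qed.

Lemma finite_large_set (f : K -> R) (eps : R) : inCK f ->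
  (forall x, non_isolated x -> `|f x| < eps) -> finite_set [set x | eps <= `|f x|].
Proof.
move=> cf fN; apply: closed_isolated_finite.
  by apply: (@inCK_closed_ge _ _ (fun x => `|f x|)); exact: inCK_norm.
move=> x /= fx; apply: contrapT => nx; have := fN x nx; lra.
Qed.

(** Soft thresholding: it erases the values of modulus at most [eps] while staying continuous. *)
Definition shrink (eps : R) (f : K -> R) (x : K) : R :=
  f x - Num.max (- eps) (Num.min eps (f x)).

Lemma inCK_shrink eps f : inCK f -> inCK (shrink eps f).
Proof.
move=> cf; apply: inCKB => //; apply: inCK_max; first exact: inCK_cst.
by apply: inCK_min => //; exact: inCK_cst.
Qed.

Lemma shrink_eq0 eps f x : 0 < eps -> `|f x| <= eps -> shrink eps f x = 0.
Proof.
by move=> e0; rewrite ler_norml => /andP[l u]; rewrite /shrink min_r// max_r// subrr.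
Qed.

Lemma shrink_dist eps f x : 0 < eps -> `|f x - shrink eps f x| <= eps.
Proof.
move=> e0; rewrite /shrink opprB addrC subrK ler_norml le_max lexx/= ge_max ge_min lexx/=.
by lra.
Qed.

(* Gliding hump: each new function is small at all non-isolated points and at the finitely many
   points where one of the previous functions is not small. *)
Lemma select_almost_disjoint (P : Type) (f : P -> K -> R) (Q : nat -> P -> P -> Prop) (p0 : P) :
  finite_set (@non_isolated K) ->
  (forall n p (F : set K) eps, finite_set F -> 0 < eps ->
    exists q, [/\ Q n p q, in_sphere (f q) & forall x, F x -> `|f q x| < eps]) ->
  exists p : nat -> P, (forall n, Q n (p n) (p n.+1)) /\ almost_disjoint (fun n => f (p n.+1)).
Proof.
move=> fN HQ.
pose eps n : R := n.+1%:R^-1.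
have eps0 n : 0 < eps n by rewrite invr_gt0.
(* A state holds the stage, the last index chosen, and a finite set on which all later functions
   must be small. *)
pose X := {x : nat * P * set K | finite_set x.2 /\ @non_isolated K `<=` x.2}.
pose S (x y : X) := let n := (sval x).1.1 in let q := (sval y).1.2 in
  [/\ (sval y).1.1 = n.+1, Q n (sval x).1.2 q, in_sphere (f q),
      forall z, (sval x).2 z -> `|f q z| < eps n &
      (sval y).2 = (sval x).2 `|` [set z | eps n <= `|f q z|]].
have step (x : X) : {y : X | S x y}.
  apply: cid; case: x => -[[n p] F] [/= fF NF].
  have [q [Qq sq fq]] := HQ n p F (eps n) fF (eps0 n).
  have fF' : finite_set (F `|` [set z | eps n <= `|f q z|]).
    rewrite finite_setU; split => //; apply: finite_large_set; first by case: sq.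
    by move=> z /NF; exact: fq.
  by exists (exist _ (n.+1, q, F `|` [set z | eps n <= `|f q z|])
    (conj fF' (subset_trans NF (@subsetUl _ _ _)))); split.
have [w [w0 Sw]] := dependent_choice step (exist (fun x : nat * P * set K =>
  finite_set x.2 /\ @non_isolated K `<=` x.2) (0%N, p0, @non_isolated K)
  (conj fN (@subset_refl _ _)) : X).
pose p n := (sval (w n)).1.2; pose F n := (sval (w n)).2.
have xn n : (sval (w n)).1.1 = n.
  by elim: n => [|n IH]; [rewrite w0|have [-> _ _ _ _] := Sw n; rewrite IH].
have FS n : F n.+1 = F n `|` [set z | eps n <= `|f (p n.+1) z|].
  by have [_ _ _ _] := Sw n; rewrite xn.
have small n z : F n z -> `|f (p n.+1) z| < eps n.
  by have [_ _ _ + _] := Sw n; rewrite xn; exact.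
have Fmono n k : F n `<=` F (n + k)%N.
  elim: k => [|k IH]; first by rewrite addn0.
  by rewrite addnS FS => z /IH; left.
have sp n : in_sphere (f (p n.+1)) by have [_ _ + _ _] := Sw n.
exists p; split; first by move=> n; have [_ + _ _ _] := Sw n; rewrite xn.
split; first exact: sp.
exists (fun n => shrink (eps n) (f (p n.+1))); split.
  by move=> n; apply: inCK_shrink; case: (sp n).
split.
  move=> n m nm; apply/disj_mulP => z; wlog : n m nm / (n < m)%N => [wl|lt_nm].
    have [|/wl|//] := ltngtP n m; first exact: wl.
    by rewrite mulrC; apply; exact: nesym.
  (* If the earlier function is large at [z], then [z] was added to the finite set, so the later
     function is small at [z] and its thresholding vanishes. *)
  have [small_n|large_n] := leP `|f (p n.+1) z| (eps n); first by rewrite shrink_eq0// mul0r.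
  rewrite mulrC shrink_eq0 ?mul0r//; apply/ltW/small.
  rewrite -(subnKC lt_nm); apply: Fmono; rewrite FS; right; exact: ltW.
apply/cvgn0P => e e0.
have [N _ HN] := near_infty_natSinv_lt (PosNum e0).
exists N => n Nn; apply: le_lt_trans (HN n Nn) => /=.
have d x : `|f (p n.+1) x - shrink (eps n) (f (p n.+1)) x| <= eps n by exact: shrink_dist.
rewrite ger0_norm; first by apply: supnorm_le => //; exact: ltW.
have [z _] : exists z : K, 1/2 < `|f (p n.+1) z|.
  by apply: supnorm_gt; [lra|case: (sp n) => _ ->; lra].
apply: le_trans (@norm_le_supnorm _ _ cK _ z _); first exact: normr_ge0.
by apply: inCKB; [case: (sp n)|apply: inCK_shrink; case: (sp n)].
Qed.

End FinitelyManyNonIsolated.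

(** The rank is at most [n < m]. It is applied to values of functions at points, once with functions
    as rows and once with points as rows. *)
Lemma tall_matrix_left_kernel (F : fieldType) m n (A : 'M[F]_(m, n)) : (n < m)%N ->
  exists c : 'rV[F]_m, c != 0 /\ c *m A = 0.
Proof.
move=> nm; exists (nz_row (kermx A)); split; last exact/sub_kermxP/nz_row_sub.
rewrite nz_row_eq0 kermx_eq0 /row_free neq_ltn.
by rewrite (leq_ltn_trans (rank_leq_col A) nm).
Qed.

(** * Kadec-Pelczynski properties and dispersed subspaces for finitely many non-isolated points *)

Section FinitelyManyNonIsolated.
Context (R : realType) (K : topologicalType).
Hypotheses (hK : hausdorff_space K) (cK : compact [set: K]).

Lemma net_null_finite (P : Type) (le : P -> P -> Prop) (f : P -> K -> R) (F : set K) eps q :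
  directed le -> (forall x, F x -> net_null le (f ^~ x)) -> finite_set F -> 0 < eps ->
  exists p, le q p /\ forall p', le p p' -> forall x, F x -> `|f p' x| < eps.
Proof.
move=> [rfl [tr [_ dir]]] fF /finite_seqP[s sF] e0.
move: fF; rewrite {F}sF; elim: s => [|a s IH] fF; first by exists q; split.
have [p [qp Hp]] := IH (fun x xs => fF x (mem_behead (s := a :: s) xs)).
have [p1 Hp1] := fF a (mem_head _ _) eps e0.
have [p2 [pp2 p1p2]] := dir p p1.
exists p2; split; first exact: tr pp2.
move=> p' p2p' x /=; rewrite inE => /orP[/eqP ->|xs]; first exact/Hp1/(tr _ p2).
by apply: Hp => //; exact: tr p2p'.
Qed.

Lemma finite_KP_pointwise : finite_set (@non_isolated K) -> @KP_pointwise R K.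
Proof.
move=> fN P le f dir sf f0 q.
(* The relation passed to the gliding hump places the n-th index above [q n]. *)
have [|p [Hp ad]] := @select_almost_disjoint R K cK P f (fun n _ p => le (q n) p) (q 0%N) fN.
  move=> n p F eps fF e0.
  have [r [qr Hr]] := net_null_finite (q n) dir (fun x _ => f0 x) fF e0.
  by exists r; split => //; apply: Hr; case: dir.
by exists (fun n => p n.+1).
Qed.

Lemma directed_leq : directed (fun n m : nat => (n <= m)%N).
Proof.
split; first exact: leqnn.
split; first by move=> p q s; exact: leq_trans.
split; first by exists 0%N.
by move=> p q; exists (maxn p q); rewrite leq_maxl leq_maxr.
Qed.

Lemma finite_seqKP_pointwise : finite_set (@non_isolated K) -> seqKP (@pointwise_null_seq R K).
Proof.
move=> fN f sf f0.
(* Here the relation [p < q] makes the selected indices strictly increasing. *)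
have [|p [Hp ad]] := @select_almost_disjoint R K cK nat f (fun _ p q => (p < q)%N) 0%N fN.
  move=> n p F eps fF e0.
  have [x _|r [qr Hr]] := @net_null_finite nat (fun n m => (n <= m)%N) f F eps p.+1
      directed_leq _ fF e0.
    by move=> e e'; move/cvgn0P: (f0 x); exact.
  by exists r; split => //; apply: Hr.
by exists (fun n => p n.+1).
Qed.

Lemma closed_subspace_sum (E : set (K -> R)) n (c : 'I_n -> R) (e : 'I_n -> K -> R) :
  closed_subspace E -> (forall i, E (e i)) -> E (fun x => \sum_(i < n) c i * e i x).
Proof.
move=> [_ [E0 [ED _]]] Ee; elim: (index_enum _) => [|i r IH].
  by rewrite (_ : (fun _ => _) = fun=> 0)//; apply/funext => x; rewrite big_nil.
rewrite (_ : (fun _ => _) = fun x => c i * e i x + \sum_(j <- r) c j * e j x).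
  exact: ED.
by apply/funext => x; rewrite big_cons.
Qed.

Lemma in_sphere_normalize (g : K -> R) : inCK g -> 0 < supnorm g ->
  in_sphere (fun x => (supnorm g)^-1 * g x).
Proof.
set d := supnorm g => cg d0.
have cdg : inCK (fun x => d^-1 * g x) by exact: inCKZ.
split => //; apply/eqP; rewrite eq_le; apply/andP; split.
  apply: supnorm_le => // x; rewrite normrM gtr0_norm ?invr_gt0// ler_pdivrMl// mulr1.
  exact: norm_le_supnorm.
rewrite -(ler_pM2l d0) mulr1; apply: supnorm_le.
  rewrite mulr_ge0 ?(ltW d0)//.
  have [y _] : exists y, d / 2 < `|g y| by apply: supnorm_gt; rewrite -/d; lra.
  exact: le_trans (normr_ge0 _) (norm_le_supnorm cK y cdg).
move=> x; have := norm_le_supnorm cK x cdg.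
by rewrite normrM gtr0_norm ?invr_gt0// ler_pdivrMl.
Qed.

(** One more independent function than there are points leaves a nontrivial combination vanishing at
    all the points; independence keeps it nonzero, so it can be normalized. *)
Lemma vanishing_unit_vector (E : set (K -> R)) (F : set K) :
  closed_subspace E -> infinite_dimensional E -> finite_set F ->
  exists g, [/\ E g, in_sphere g & forall x, F x -> g x = 0].
Proof.
move=> cE iE /finite_seqP[s ->].
have [e [Ee free_e]] := iE (size s).+1.
have [c [c0 cA]] := tall_matrix_left_kernel
  (\matrix_(i < (size s).+1, j < size s) e i (tnth (in_tuple s) j)) (ltnSn _).
pose g x := \sum_(i < (size s).+1) c ord0 i * e i x.
have Eg : E g by exact: closed_subspace_sum.
have cg : inCK g by case: cE => H _; exact: H.
have gs x : x \in s -> g x = 0.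
  move=> xs; have lt : (index x s < size s)%N by rewrite index_mem.
  have := congr1 (fun M : 'rV_ _ => M ord0 (Ordinal lt)) cA.
  rewrite !mxE => H; rewrite -[RHS]H; apply: eq_bigr => i _.
  by rewrite !mxE (tnth_nth x) /= nth_index.
have g_pos : 0 < supnorm g.
  have [y gy] : exists y, g y <> 0.
    apply: contrapT => ng; move/eqP: c0; apply; apply/rowP => i; rewrite mxE.
    by apply: (free_e (c ord0)) => y; apply: contrapT => gy; apply: ng; exists y.
  by apply: lt_le_trans (norm_le_supnorm cK y cg); rewrite normr_gt0; exact/eqP.
set d := supnorm g in g_pos *.
exists (fun x => d^-1 * g x); split.
- case: cE => _ [E0 [ED _]]; have := ED d^-1 g (fun=> 0) Eg E0.
  by rewrite (_ : (fun _ => _) = fun x => d^-1 * g x)//; apply/funext => x; rewrite addr0.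
- exact: in_sphere_normalize.
- by move=> x /gs ->; rewrite mulr0.
Qed.

Lemma finite_not_dispersed (E : set (K -> R)) : finite_set (@non_isolated K) ->
  infinite_dimensional E -> ~ dispersed E.
Proof.
move=> fN iE [cE]; apply.
(* The family is indexed by the functions themselves, and the relation records membership in [E]. *)
have [|p [Ep ad]] := @select_almost_disjoint R K cK (K -> R) id (fun _ _ g => E g) (fun=> 0) fN.
  move=> _ _ F eps fF e0; have [g [Eg sg gF]] := vanishing_unit_vector cE iE fF.
  by exists g; split => // x /gF ->; rewrite normr0.
by exists (fun n => p n.+1).
Qed.

(** The disjoint functions approximating an almost disjoint sequence of [E] become, once normalized,
    disjoint unit vectors arbitrarily close to [E]. *)
Lemma two_dispersed_dispersed (E : set (K -> R)) : two_dispersed E -> dispersed E.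
Proof.
move=> [cE [r [r0 nE]]]; split => // -[e [Ee [se [g [cg [dg /cvgn0P lim]]]]]].
(* The bound 1/4 keeps the norm of [g n] above 1/2, so normalizing at most doubles the distance; the
   bound [r / 4] then gives [2 * d < r]. *)
pose d := Num.min (1/4) (r / 4).
have d0 : 0 < d by rewrite lt_min; lra.
have [d1 d2] : d <= 1/4 /\ d <= r / 4 by rewrite !ge_min !lexx orbT.
have [N HN] := lim d d0; apply: nE.
have near n : (N <= n)%N -> forall x, `|e n x - g n x| <= d.
  move=> Nn x; apply: le_trans (ltW (le_lt_trans (ler_norm _) (HN n Nn))).
  by apply: (@norm_le_supnorm _ _ cK (e n \- g n)); apply: inCKB; [case: (se n)|].
have large n : (N <= n)%N -> 1/2 <= supnorm (g n).
  move=> Nn; have [z ez] : exists z, 3/4 < `|e n z|.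
    by apply: supnorm_gt; [lra|case: (se n) => _ ->; lra].
  have := near n Nn z; have := lerB_dist (e n z) (g n z).
  by have := norm_le_supnorm cK z (cg n); lra.
pose u n x := (supnorm (g n))^-1 * g n x.
have su n : (N <= n)%N -> in_sphere (u n).
  by move=> /large gn; apply: in_sphere_normalize => //; lra.
have du n : (N <= n)%N -> dist (u n) E < r.
  move=> Nn; have gn := large n Nn; pose a := (supnorm (g n))^-1.
  have Ea : E (fun x => a * e n x).
    case: cE => _ [E0 [ED _]]; have := ED a (e n) (fun=> 0) (Ee n) E0.
    by rewrite (_ : (fun _ => _) = fun x => a * e n x)//; apply/funext => x; rewrite addr0.
  have a0 : 0 <= a by rewrite invr_ge0; lra.
  have a2 : a <= 2 by rewrite -[2]invrK lef_pV2 ?posrE; lra.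
  apply: (@le_lt_trans _ _ (2 * d)); last by lra.
  apply: (@le_trans _ _ (supnorm (u n \- (fun x => a * e n x)))).
    apply: ge_inf; last by exists (fun x => a * e n x).
    exists 0 => _ [h Eh <-]; have [z _] : exists z, 3/4 < `|e n z|.
      by apply: supnorm_gt; [lra|case: (se n) => _ ->; lra].
    apply: le_trans (normr_ge0 _) (norm_le_supnorm cK z _); apply: inCKB.
      by case: (su n Nn).
    by case: cE => + _; apply.
  apply: supnorm_le; first by lra.
  move=> x /=; rewrite /u -/a -mulrBr normrM distrC (ger0_norm a0).
  by have := near n Nn x; have := normr_ge0 (e n x - g n x); nra.
exists (u N), (u N.+1); split; first exact: su.
split; first exact: su.
split; last by split; exact: du.
apply/disj_mulP => x; rewrite /u mulrACA.
by have /disj_mulP -> := dg N N.+1 (n_Sn N); rewrite mulr0.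
Qed.
End FinitelyManyNonIsolated.

(** * The order continuous part *)

Section OrderContinuousPart.
Context (R : realType) (K : topologicalType).
Hypotheses (hK : hausdorff_space K) (cK : compact [set: K]).

(* If [f t <> 0] at a non-isolated t, the functions [0 <= g <= |f|] with [g t = |f t|] decrease
   to 0 in C(K), since their infimum is 0 off t, but not in norm. *)
Lemma oc_part_vanishes (f : K -> R) (t : K) : oc_part f -> non_isolated t -> f t = 0.
Proof.
move=> [I [[IC [_ [_ Isolid]]] [oc If]]] nt; apply: contrapT => ft0.
have cf := IC f If.
have cfn : inCK (fun x => `|f x|) by exact: inCK_norm.
pose Q (g : K -> R) := [/\ inCK g, forall x, 0 <= g x <= `|f x| & g t = `|f t|].
pose P := {g | Q g}.
pose le (p q : P) := forall x, sval q x <= sval p x.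
have mk (u : K -> R) : bump_fun u -> u t = 1 -> {p : P | forall x, sval p x = `|f x| * u x}.
  move=> bu ut; have H : Q (fun x => `|f x| * u x).
    split; first by apply: inCKM => //; case: bu.
      move=> x; have := bump_ge0 x bu; have := bump_le1 x bu; have := normr_ge0 (f x).
      by nra.
    by rewrite ut mulr1.
  by exists (exist Q _ H).
have dir : directed le.
  split; first by move=> p x.
  split; first by move=> p q s pq qs x; exact: le_trans (qs x) (pq x).
  split.
    have b1 : bump_fun (fun _ : K => 1 : R).
      by split; [exact: inCK_cst|move=> _; rewrite ler01 lexx].
    by have [p _] := mk _ b1 erefl; exists p.
  move=> [p [cp bp pt]] [q [cq bq qt]].
  have H : Q (fun x => Num.min (p x) (q x)).
    split; first exact: inCK_min.
      move=> x; have /andP[p0 p1] := bp x; have /andP[q0 q1] := bq x.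
      by rewrite le_min p0 q0 ge_min p1.
    by rewrite pt qt minxx.
  by exists (exist Q _ H); split => x /=; rewrite ge_min lexx ?orbT.
have [p Hp] : exists p0, forall p, le p0 p -> `|supnorm (sval p)| < `|f t|.
  apply: (oc P le (fun p => sval p)) => //.
  - move=> [p [cp bp pt]] /=; apply: (Isolid f) => // x; have /andP[p0 p1] := bp x.
    by rewrite ger0_norm.
  - split; first by case=> p [].
    split; first by move=> p q; exact.
    split; first by case=> p [_ bp _] x /=; have /andP[] := bp x.
    move=> g cg gp.
    have g0 s : s <> t -> g s <= 0.
      move=> st; have [u [bu us ut]] := bump_separates R hK cK st.
      have [p pE] := mk u bu ut.
      by have := gp p s; rewrite pE us mulr0.
    move=> s; have [->|/eqP/g0//] := eqVneq s t.
    (* A lower bound positive at [t] would be positive only there, making [[set t]] open. *)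
    rewrite leNgt; apply/negP => gt; apply: nt.
    rewrite (_ : [set t] = [set x | 0 < g x]); first exact: inCK_open_gt.
    apply/seteqP; split => x /=; first by move=> ->.
    by move=> gx; apply: contrapT => /g0; lra.
  - by rewrite normr_gt0; exact/eqP.
have := Hp p (fun x => lexx _); case: p {Hp} => p [cp bp pt] /=.
apply/negP; rewrite -leNgt; apply: le_trans (ler_norm _).
by have := norm_le_supnorm cK t cp; rewrite pt normr_id.
Qed.

(** By [oc_part_vanishes] and [norm_oc_on_vanishing_ideal] this is exactly the order continuous
    part. *)
Definition vanishing_ideal : set (K -> R) :=
  [set f | inCK f /\ forall t, non_isolated t -> f t = 0].

Lemma ideal_vanishing_ideal : ideal vanishing_ideal.
Proof.
split; first by move=> f [].
split; first by split; first exact: inCK_cst.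
split.
  move=> a f g [cf f0] [cg g0]; split; first by apply: inCKD => //; exact: inCKZ.
  by move=> t nt; rewrite f0// g0// mulr0 addr0.
move=> f g [cf f0] cg gf; split => // t nt; apply/eqP.
by have := gf t; rewrite f0// normr0 normr_le0.
Qed.

(** At an isolated point [e] times the indicator of [t] is continuous; it would be a lower bound of
    a net staying above [e] at [t]. *)
Lemma decr_to_0_isolated (P : Type) (le : P -> P -> Prop) (f : P -> K -> R) (t : K) :
  decr_to_0 le f -> open [set t] -> net_null le (f ^~ t).
Proof.
move=> [cf [dec [f0 inf0]]] ot e e0.
have [p pe] : exists p, f p t < e.
  apply: contrapT => H.
  suff : e <= 0 by lra.
  have := inf0 _ (inCK_indic (c := e) hK ot) _ t; rewrite eqxx; apply => p x.
  case: eqP => [->|_]; last exact: f0.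
  by rewrite leNgt; apply/negP => pe; apply: H; exists p.
by exists p => q pq; rewrite ger0_norm//; apply: le_lt_trans pe; exact: dec.
Qed.

(** A Dini argument: [f p0] reaches [e / 2] only on a finite set of isolated points, where the net
    tends to 0; elsewhere monotonicity keeps it below [e / 2]. *)
Lemma norm_oc_on_vanishing_ideal : norm_oc_on vanishing_ideal.
Proof.
move=> P le f dir fI df e e0.
have [p0] : exists p : P, True by case: dir => _ [_ []].
move=> _; have [cf [dec [f0 _]]] := df.
have e2 : 0 < e / 2 by lra.
pose F := [set x | e / 2 <= `|f p0 x|].
have isoF x : F x -> open [set x].
  by move=> Fx; apply: contrapT => nx; have [_ H] := fI p0; move: Fx;
    rewrite /F /= H// normr0; lra.
have fF : finite_set F.
  by apply: finite_large_set => // x nx; have [_ ->//] := fI p0; rewrite normr0.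
have [p [p0p Hp]] := net_null_finite p0 dir
  (fun x Fx => decr_to_0_isolated df (isoF x Fx)) fF e2.
exists p => q pq; rewrite ger0_norm ?supnorm_ge0//.
apply: (@le_lt_trans _ _ (e / 2)); last by lra.
apply: supnorm_le => [|x]; first exact: ltW.
have [Fx|/negP] := boolP (e / 2 <= `|f p0 x|); first exact/ltW/Hp.
move/negP; rewrite -ltNge => /ltW; apply: le_trans.
rewrite !ger0_norm//; apply: dec; case: dir => _ [tr _]; exact: tr pq.
Qed.

(** Lagrange interpolation at the non-isolated points: products of separating functions give a dual
    basis [g], and subtracting the interpolant of [f] leaves a function vanishing at those
    points. *)
Lemma finite_codim_oc_part : finite_set (@non_isolated K) -> finite_codim (@oc_part R K).
Proof.
move=> /finite_seqP[s0 Ns0].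
pose s := undup s0.
have Ns t : non_isolated t -> t \in s by rewrite mem_undup Ns0.
have /choice[u uP] : forall xy : K * K, exists u : K -> R, xy.1 <> xy.2 ->
    [/\ bump_fun u, u xy.1 = 0 & u xy.2 = 1].
  move=> [x y] /=; have [->|/eqP xy] := eqVneq x y; first by exists (fun=> 0).
  by have [u uP] := bump_separates R hK cK xy; exists u.
pose pt (i : 'I_(size s)) := tnth (in_tuple s) i.
pose g (i : 'I_(size s)) x := \prod_(y <- s | y != pt i) u (y, pt i) x.
have gE i j : g i (pt j) = (i == j)%:R.
  have ptI : injective pt.
    move=> a b; have x0 := pt a; rewrite /pt !(tnth_nth x0) /= => /eqP.
    by rewrite nth_uniq ?undup_uniq// => /eqP/val_inj.
  have [->|ij] := eqVneq i j.
    by rewrite /g big1// => y /eqP yj; have [] := uP (y, pt j) yj.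
  have ptij : pt j != pt i by apply: contra_neq ij => /ptI.
  apply/eqP; rewrite /g (big_rem (pt j)) ?mem_tnth//= ptij.
  by have [//|_ -> _] := uP (pt j, pt i); [exact/eqP|rewrite mul0r].
have cg i : inCK (g i).
  by apply: inCK_prod => y /eqP yi; have [//|[]] := uP (y, pt i).
exists (size s), g; split => // f cf; exists (f \o pt).
exists vanishing_ideal; split; first exact: ideal_vanishing_ideal.
split; first exact: norm_oc_on_vanishing_ideal.
split.
  by apply: inCKB => //; apply: inCK_sum => i _; exact: inCKZ.
move=> t /Ns ts.
have lt : (index t s < size s)%N by rewrite index_mem.
have -> : t = pt (Ordinal lt) by rewrite /pt (tnth_nth t) /= nth_index.
rewrite (bigD1 (Ordinal lt))//= gE eqxx mulr1 big1 ?addr0 ?subrr// => j ji.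
by rewrite gE (negbTE ji) mulr0.
Qed.

(** Given [n.+1] non-isolated points, some nontrivial combination of their evaluations kills the [n]
    functions [g j]. It kills the order continuous part as well, hence all of C(K), yet on the bump
    [f i] it takes the value [c ord0 i]. *)
Lemma finite_codim_finite : finite_codim (@oc_part R K) -> finite_set (@non_isolated K).
Proof.
move=> [n [g [cg gP]]]; apply: contrapT => /(disjoint_bumps R hK cK)[y [f [Ny bf fy df]]].
have [c [c0 cA]] := tall_matrix_left_kernel (\matrix_(i < n.+1, j < n) g j (y i)) (ltnSn n).
move/eqP: c0; apply; apply/rowP => i; rewrite mxE.
have [|d dP] := gP (f i); first by case: (bf i).
have fE (k : 'I_n.+1) : f i (y k) = \sum_(j < n) d j * g j (y k).
  by apply/eqP; rewrite -subr_eq0; apply/eqP; exact: (oc_part_vanishes dP (Ny k)).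
transitivity (\sum_(k < n.+1) c ord0 k * f i (y k)).
  rewrite (bigD1 i)//= fy mulr1 big1 ?addr0// => k ki.
  have := df i k (y k); rewrite fy mulr1 => ->; first by rewrite mulr0.
  by move=> /val_inj ik; rewrite ik eqxx in ki.
transitivity (\sum_(j < n) d j * \sum_(k < n.+1) c ord0 k * g j (y k)).
  under eq_bigr do rewrite fE mulr_sumr.
  rewrite exchange_big /=; apply: eq_bigr => j _; rewrite mulr_sumr.
  by apply: eq_bigr => k _; rewrite mulrCA.
rewrite big1// => j _; have := congr1 (fun M : 'rV_ _ => M ord0 j) cA.
rewrite !mxE => H; rewrite -[RHS](mulr0 (d j)) -[in RHS]H; congr (_ * _).
by apply: eq_bigr => k _; rewrite !mxE.
Qed.
End OrderContinuousPart.

(** * The equivalences, by cases on the finiteness of the set of non-isolated points *)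

Theorem mainTheorem4 (R : realType) (K : topologicalType)
    (hK : hausdorff_space K) (cK : compact [set: K]) :
  let i  := finite_set (@non_isolated K) in
  let ii := finite_codim (@oc_part R K) in
  let iii := @KP_pointwise R K in
  let iii' := seqKP (@pointwise_null_seq R K) in
  let iv := seqKP (@weak_null_seq R K) in
  let iv' := seqKP (@absweak_null_seq R K) in
  let v := ~ (exists E : set (K -> R), dispersed E /\ infinite_dimensional E) in
  let v' := ~ (exists E : set (K -> R), two_dispersed E /\ infinite_dimensional E) in
  (i <-> ii) /\ (i <-> iii) /\ (i <-> iii') /\ (i <-> iv) /\ (i <-> iv') /\ (i <-> v) /\ (i <-> v').
Proof.
move=> i ii iii iii' iv iv' v v'.
(* Fewer null sequences make the property weaker; weak and absolute weak convergence both imply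
   pointwise convergence. *)
have seq_weaken (null null' : (nat -> K -> R) -> Prop) :
    (forall f, (forall n, in_sphere (f n)) -> null f -> null' f) ->
    seqKP null' -> seqKP null.
  by move=> nn KP f sf nf; apply: KP => //; exact: nn.
have i_iii' : i -> iii' by exact: finite_seqKP_pointwise.
have i_v : i -> v by move=> fN [E [dE iE]]; exact: finite_not_dispersed dE.
have v_v' : v -> v' by move=> nv [E [dE iE]]; apply: nv; exists E; split => //;
  exact: two_dispersed_dispersed.
(* In the infinite case every condition fails, by the entangled sequence or its span; in the finite
   case every condition holds. *)
have [fN|nfN] := pselect i; last first.
  have [f [t [s [bf ft fs f2 fev]]]] := entangled_bumps R hK cK nfN.
  have sf n : in_sphere (f n) by exact: entangled_in_sphere.
  have wf : weak_null_seq f by exact: entangled_weak_null f2.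
  have af : absweak_null_seq f by exact: entangled_absweak_null f2.
  have pf : pointwise_null_seq f by exact: weak_null_pointwise.
  have no_subseq (p : nat -> nat) : ~ almost_disjoint (fun n => f (p n)).
    exact: (entangled_subseq_not_almost_disjoint cK ft fs).
  have no_seqKP null : null f -> ~ seqKP null.
    by move=> nf /(_ f sf nf)[p [_]]; exact: no_subseq.
  have no_v' : ~ v'.
    move=> nv; apply: nv; exists (entangled_span f t).
    split; last exact: (entangled_span_infinite_dimensional bf ft).
    exact: (entangled_span_two_dispersed cK bf ft fs f2 fev).
  have no_iii : ~ iii.
    have pnet : pointwise_null_net (fun n m => (n <= m)%N) f.
      by move=> x e e0; move/cvgn0P: (pf x); exact.
    by move=> /(_ nat _ f directed_leq sf pnet id)[p [_]]; exact: no_subseq.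
  split; first by split => // /(finite_codim_finite hK cK).
  split; first by split.
  split; first by split => // /(no_seqKP _ pf).
  split; first by split => // /(no_seqKP _ wf).
  split; first by split => // /(no_seqKP _ af).
  by split; split => //; tauto.
split; first by split => // _; exact: finite_codim_oc_part.
split; first by split => // _; exact: finite_KP_pointwise.
split; first by split => // _; exact: i_iii'.
split.
  split => // _; apply: seq_weaken (i_iii' fN) => f sf; exact: weak_null_pointwise.
split.
  split => // _; apply: seq_weaken (i_iii' fN) => f sf; apply: absweak_null_pointwise => // n.
  by case: (sf n).
by split; split => // _; first [exact: i_v|exact/v_v'/i_v].
Qed.
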